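(* Let $k\ge 2$ be an even integer. Let $y_1,\dots,y_{k/2}$ be the squares of the $k$ non-zero roots of the Hermite polynomial $He_{k+1}$ (these roots are symmetric about zero, so there are only $k/2$ distinct squares), and let $p_1,\dots,p_{k/2}$ be the solution of $$\sum_{i=1}^{k/2} p_i\, y_i^{\,j} = M_{2j}/2,\qquad j=1,\dots,k/2 .$$ Let $F^*$ be the c.d.f. of the symmetric discrete distribution with mass $p_i$ at each of $\pm\sqrt{y_i}$ ($i=1,\dots,k/2$) and mass $p_0=1-2\sum_{i=1}^{k/2}p_i$ at zero; this distribution matches $k$ even normal moments. Let $\Phi$ be the standard normal c.d.f. and let $$M=\bigl(M_{2(a+b)}\bigr)_{0\le a,b\le k/2}$$ be the Hankel matrix of even normal moments. Then $F^*$ achieves one half of the bound $1/(M^{-1})_{1,1}$, i.e. $$F^*(0)-\Phi(0)=\frac{1}{2}\cdot\frac{1}{(M^{-1})_{1,1}},$$ and therefore it is least favorable: among all distributions matching $k$ even normal moments it maximizes the difference $|F(0)-\Phi(0)|$ from the normal c.d.f. at zero (equivalently, it maximizes the mass at zero).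
   Context: $M_\ell = E\,Z^\ell$ with $Z\sim N(0,1)$. $He_n$ is the probabilists' Hermite polynomial of degree $n$, orthogonal with respect to the standard normal density. $(M^{-1})_{1,1}$ is the upper left entry of $M^{-1}$ (the entry indexed by $a=b=0$). A distribution on $\mathbb{R}$ (of a random variable $X$) matches $k$ even normal moments if $E X^{j}=M_j$ for all $j=1,\dots,2k$; that is, the even moments $M_2,\dots,M_{2k}$ are matched and the odd moments up to order $2k-1$ vanish, as they do for symmetric distributions. *)

(* Defs.v *)
From HB Require Import structures.
From mathcomp Require Import all_boot all_order all_algebra.
From mathcomp Require Import all_classical all_reals all_analysis.

Set Implicit Arguments.
Unset Strict Implicit.
Unset Printing Implicit Defensive.
Import Order.TTheory GRing.Theory Num.Theory.
Import numFieldNormedType.Exports.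
Local Open Scope classical_set_scope.
Local Open Scope ring_scope.

Notation real_distribution R := (probability (measurableTypeR R) R).

Definition std_normal (R : realType) : real_distribution R := normal_prob 0 1.

Definition normal_moment (R : realType) (l : nat) : R :=
  fine ('E_(std_normal R)[(fun x : R => x ^+ l)%R])%E.

Definition matches_even_normal_moments (R : realType) (k : nat)
    (P : real_distribution R) : Prop :=
  forall j : nat, (1 <= j <= 2 * k)%N ->
    P.-integrable setT (fun x : R => (x ^+ j)%:E) /\
    ('E_P[(fun x : R => x ^+ j)%R] = (normal_moment R j)%:E)%E.

Definition dcdf (R : realType) (P : real_distribution R) (x : R) : R :=
  fine (P [set` `]-oo, x]]).

(* Rodrigues' formula He_n(x) = (-1)^n exp(x^2/2) (d/dx)^n exp(-x^2/2),
   with the exponential factors cancelled. *)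
Fixpoint hermite (R : realType) (n : nat) : {poly R} :=
  if n is n'.+1 then 'X * hermite R n' - (hermite R n')^`() else 1.

(* Injectivity makes [y] an enumeration of exactly [m] distinct squares. *)
Definition enum_sq_nonzero_roots (R : realType) (q : {poly R}) (m : nat)
    (y : 'I_m -> R) : Prop :=
  injective y /\
  forall t : R, (exists i, y i = t) <->
                (exists x : R, [/\ x != 0, root q x & x ^+ 2 = t]).

(* Indices in ['I_(k./2)] start at 0 while the powers [j] start at 1. *)
Definition weight_system (R : realType) (k : nat) (y p : 'I_(k./2) -> R)
    : Prop :=
  forall j : nat, (1 <= j <= k./2)%N ->
    \sum_(i < k./2) p i * y i ^+ j = normal_moment R (2 * j) / 2%:R.

Definition mass_at_zero (R : realType) (m : nat) (p : 'I_m -> R) : R :=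
  1 - 2%:R * \sum_(i < m) p i.

(* For arbitrary real weights this only defines a signed set function. *)
Definition symmetric_discrete (R : realType) (m : nat) (y p : 'I_m -> R)
    (A : set R) : \bar R :=
  ((mass_at_zero p)%:E * \d_(0%R : R) A +
   \sum_(i < m) (p i)%:E *
     (\d_(Num.sqrt (y i)) A + \d_((- Num.sqrt (y i))%R) A))%E.

Definition normal_hankel (R : realType) (m : nat) : 'M[R]_m.+1 :=
  \matrix_(a < m.+1, b < m.+1) normal_moment R (2 * (a + b)).

(* Main.v *)
Require Import Defs.
From HB Require Import structures.
From mathcomp Require Import all_boot all_order all_algebra.
From mathcomp Require Import all_classical all_reals all_analysis.
From mathcomp Require Import measurable_realfun polyrcf ring lra.

(* The law F* is the (k+1)-point Gauss quadrature of the normal law: He_(k+1) is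
   orthogonal to all polynomials of lower degree, which forces its roots to be
   real and simple, the weights to be positive and the quadrature to be exact up
   to degree 2k+1.  Let V(t) = prod_i (1 - t/y_i) and w = V^2.  The coefficient
   vector of V is sent by the Hankel matrix to p_0 e_0, which gives
   p_0 = 1/(M^-1)_(1,1).

   For any matching Q, w(x^2) is a polynomial majorant of the indicator of {0}
   of degree 2k, so Q{0} <= E w(Z^2) = p_0.  For the c.d.f. we need
   |E_Q sgn| <= p_0 - Q{0}.  For s > 0 one has
     x/(x^2+s) = U_s(x) + (w(x^2)/w(-s)) x/(x^2+s)
   with U_s an odd polynomial of degree < 2k, so that E_Q U_s = 0, and
   w(-s) >= 1.  Hence every nonnegative combination f of these kernels satisfies
   |E_Q f| <= E_Q[w(X^2) |f(X)|].  Riemann sums of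
   (pi/2) sgn x = int_0^oo x/(x^2+r^2) dr are such combinations, and passing to
   the limit gives the bound. *)

Set Implicit Arguments.
Unset Strict Implicit.
Unset Printing Implicit Defensive.
Import Order.TTheory GRing.Theory Num.Theory.
Import numFieldNormedType.Exports.
Local Open Scope classical_set_scope.
Local Open Scope ring_scope.

(** * Moments of the normal law *)

Section normal_integral.
Context {R : realType}.
Variables m s : R.
Let mu := @lebesgue_measure R.
Local Open Scope ereal_scope.

(** The Radon-Nikodym derivative of the normal law and [normal_pdf] have the same integral over
    every measurable set, hence agree almost everywhere; the change of variables formula for the
    former gives the claim. *)
Lemma ge0_integral_normal_prob (f : R -> \bar R) :
    measurable_fun setT f -> (forall x, 0 <= f x) ->
  \int[normal_prob m s]_x f x = \int[mu]_x (f x * (normal_pdf m s x)%:E).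
Proof.
move=> mf f0.
have dom := normal_prob_dominates m s.
rewrite -(Radon_Nikodym_SigmaFinite.change_of_variables dom)//.
have iRN := Radon_Nikodym_SigmaFinite.f_integrable dom.
have mpdf : measurable_fun setT (EFin \o normal_pdf m s).
  apply/measurable_EFinP; exact: measurable_normal_pdf.
apply: ae_eq_integral => //.
- apply: emeasurable_funM => //; exact: measurable_int iRN.
- exact: emeasurable_funM.
- apply: ae_eqe_mul2l.
  apply: integral_ae_eq => // E _ mE.
  by rewrite -Radon_Nikodym_SigmaFinite.f_integral.
Qed.

Lemma integrable_normal_prob (f : R -> R) : measurable_fun setT f ->
  mu.-integrable setT (fun x => (f x * normal_pdf m s x)%:E) ->
  (normal_prob m s).-integrable setT (EFin \o f).
Proof.
move=> mf /integrableP[_ ifin]; apply/integrableP; split.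
  exact/measurable_EFinP.
rewrite ge0_integral_normal_prob//; last first.
  by apply: measurableT_comp => //; exact/measurable_EFinP.
apply: le_lt_trans ifin; rewrite le_eqVlt; apply/orP; left; apply/eqP.
apply: eq_integral => x _ /=.
by rewrite normrM (ger0_norm (normal_pdf_ge0 _ _ _)) EFinM.
Qed.

Lemma integral_normal_prob (f : R -> R) : measurable_fun setT f ->
  \int[normal_prob m s]_x (f x)%:E
  = \int[mu]_x (f x * normal_pdf m s x)%:E.
Proof.
move=> mf; rewrite integralE [RHS]integralE.
have mf' : measurable_fun setT (EFin \o f) by exact/measurable_EFinP.
rewrite !ge0_integral_normal_prob//; last 2 first.
- exact: measurable_funeneg.
- exact: measurable_funepos.
congr (_ - _); apply: eq_integral => x _.
- by rewrite !funeposE EFinM maxeMl ?mul0e// lee_fin normal_pdf_ge0.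
- rewrite !funenegE EFinM maxeMl ?mul0e ?muleN ?mulNe//.
  by rewrite lee_fin normal_pdf_ge0.
Qed.

End normal_integral.

(** * Integration by parts and the recursion for normal moments *)

Section normal_moments.
Context {R : realType}.
Let mu := @lebesgue_measure R.
Local Notation phi := (normal_pdf (0 : R) 1).

(** The fundamental theorem of calculus on growing symmetric intervals, followed by dominated
    convergence with dominating function |f|. *)
Lemma integral_derive_eq0 (F f : R -> R) :
  (forall x : R, is_derive x 1 F (f x)) -> continuous f ->
  mu.-integrable setT (EFin \o f) ->
  F n%:R @[n --> \oo] --> 0 -> F (- n%:R) @[n --> \oo] --> 0 ->
  (\int[mu]_x (f x)%:E = 0)%E.
Proof.
move=> dF cf intf Fp Fm.
have dF1 x : derivable F x 1 by have [] := dF x.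
have cF : continuous F.
  by move=> x; apply/differentiable_continuous/derivable1_diffP/dF1.
(* [n.+1] rather than [n] keeps the interval nondegenerate, as [continuous_FTC2] requires. *)
pose A (n : nat) := [set` `[- n.+1%:R : R, n.+1%:R]].
have FTC n : (\int[mu]_(x in A n) (f x)%:E = (F n.+1%:R - F (- n.+1%:R))%:E)%E.
  rewrite EFinB; apply: continuous_FTC2.
  - by rewrite -subr_gt0 opprK; apply: addr_gt0.
  - exact: continuous_subspaceT.
  - split; first by move=> x _; exact: dF1.
    + by apply: cvg_at_right_filter; exact: cF.
    + by apply: cvg_at_left_filter; exact: cF.
  - by move=> x _; rewrite derive1E; have [_ ->] := dF x.
have mA n : measurable (A n) by exact: measurable_itv.
have mf : measurable_fun setT (EFin \o f) by exact: measurable_int intf.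
have [] := @dominated_convergence _ _ _ mu setT measurableT
  (fun n => (EFin \o f) \_ (A n)) (EFin \o f) (abse \o (EFin \o f)) _ mf.
- move=> n; apply/(measurable_restrict _ (mA n) measurableT).
  exact: measurable_funTS.
- apply: aeW => x _; apply: cvg_near_cst.
  near=> n; rewrite patchE ifT// inE /A /= in_itv/= -ler_norml.
  near: n; exists (Num.truncn `|x|).+1 => // i /= xi.
  rewrite (le_trans (ltW (truncnS_gt _)))// ler_nat.
  exact: leqW.
- exact: integrable_abse.
- by apply: aeW => x n _; rewrite patchE; case: ifP => // _; rewrite abse0 abse_ge0.
move=> _ _ cvgf.
apply: (cvg_unique _ cvgf) => //.
have -> : [sequence (\int[mu]_(x in setT) ((EFin \o f) \_ (A n)) x)%E]_n =
    fun n => (F n.+1%:R - F (- n.+1%:R))%:E.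
  by apply/funext => n; rewrite -FTC [RHS]integral_mkcond.
apply: cvg_EFin; first by near=> n.
have -> : 0 = 0 - 0 :> R by rewrite subr0.
apply: cvgB.
- by move: Fp; rewrite -(cvg_shiftS (fun n => F n%:R)).
- by move: Fm; rewrite -(cvg_shiftS (fun n => F (- n%:R))).
Unshelve. all: by end_near. Qed.

Lemma normal_pdf01E (x : R) : phi x = normal_peak 1 * expR (- (x ^+ 2 / 2)).
Proof.
rewrite normal_pdfE ?oner_neq0// /normal_fun subr0 expr1n.
by rewrite mulNr.
Qed.

(** With c = 4(n+1), the inequality 1 + u <= exp u gives |x| <= c exp(x^2/c); in the n-th power the
    exponent becomes n x^2/c <= x^2/4. *)
Lemma normr_exprn_le_expR n (x : R) :
  `|x| ^+ n <= (4 * n.+1)%:R ^+ n * expR (x ^+ 2 / 4).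
Proof.
set c : R := (4 * n.+1)%:R.
have c0 : 0 < c by rewrite ltr0n.
have c4 : 4 <= c by rewrite ler_nat leq_pmulr.
have h : `|x| <= c * expR (x ^+ 2 / c).
  apply: (@le_trans _ _ (c * (1 + x ^+ 2 / c))); last first.
    by rewrite ler_pM2l// expR_ge1Dx.
  rewrite mulrDr mulr1 mulrCA mulfV ?gt_eqF// mulr1 -(real_normK (num_real x)).
  by have := normr_ge0 x; nra.
apply: le_trans (_ : (c * expR (x ^+ 2 / c)) ^+ n <= _).
  by rewrite lerXn2r// nnegrE mulr_ge0 ?expR_ge0// ltW.
rewrite exprMn ler_pM2l ?exprn_gt0// -expRM_natl ler_expR.
rewrite mulrCA ler_wpM2l ?sqr_ge0// ler_pdivrMr// /c natrM.
by rewrite mulrA mulVf ?mul1r ?ler_nat//.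
Qed.

(** Half of the Gaussian exponent absorbs the power: exp(x^2/4) exp(-x^2/2) = exp(-x^2/4) is, up to
    a constant, the normal density of variance 2. *)
Lemma exprn_normal_pdf_le n : exists2 C : R, 0 <= C &
  forall x : R, `|x ^+ n * phi x| <= C * normal_pdf 0 (Num.sqrt 2) x.
Proof.
have s2 : Num.sqrt 2 != 0 :> R by rewrite sqrtr_eq0 -ltNge.
have p2 := normal_peak_gt0 s2.
exists ((4 * n.+1)%:R ^+ n * normal_peak 1 / normal_peak (Num.sqrt 2)).
  by rewrite mulr_ge0 ?invr_ge0 ?mulr_ge0 ?normal_peak_ge0.
move=> x; rewrite normrM normrX (ger0_norm (normal_pdf_ge0 _ _ _)).
rewrite normal_pdf01E normal_pdfE// /normal_fun subr0 sqr_sqrtr// mulrCA.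
have -> (c a b e : R) : b != 0 -> c * a / b * (b * e) = a * (c * e).
  by move=> b0; field.
2: by rewrite gt_eqF.
apply: ler_wpM2l; first exact: normal_peak_ge0.
apply: le_trans (ler_wpM2r (expR_ge0 _) (normr_exprn_le_expR n x)) _.
rewrite -mulrA -expRD ler_wpM2l ?exprn_ge0// ler_expR.
by rewrite mulNr le_eqVlt; apply/orP; left; apply/eqP; field.
Qed.

Lemma continuous_exprn_normal_pdf n : continuous (fun x : R => x ^+ n * phi x).
Proof.
move=> x; apply: cvgM; first exact: exprn_continuous.
by apply: continuous_normal_pdf; exact: oner_neq0.
Qed.

Lemma integrable_exprn_normal_pdf n :
  mu.-integrable setT (fun x : R => (x ^+ n * phi x)%:E).
Proof.
have [C C0 hC] := exprn_normal_pdf_le n.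
have := @integrableZl _ _ _ mu setT measurableT C _
  (integrable_normal_pdf 0 (Num.sqrt 2)).
apply: le_integrable => //.
  apply/measurable_EFinP; apply: continuous_measurable_fun.
  exact: continuous_exprn_normal_pdf.
move=> x _ /=; rewrite lee_fin; apply: le_trans (hC x) _.
by rewrite ler_norm.
Qed.

(** Boundary terms for the integration by parts, at both ends at once. The bound for exponent
    [n.+1], divided by |u i|, yields decay of order 1/i. *)
Lemma cvg_exprn_normal_pdf n (u : nat -> R) : (forall i, `|u i| = i%:R) ->
  u i ^+ n * phi (u i) @[i --> \oo] --> 0.
Proof.
move=> hu; have [C C0 hC] := exprn_normal_pdf_le n.+1.
have s2 : Num.sqrt 2 != 0 :> R by rewrite sqrtr_eq0 -ltNge.
set D := C * normal_peak (Num.sqrt 2).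
rewrite -(cvg_shiftS (fun i => u i ^+ n * phi (u i))).
apply/norm_cvg0P.
apply: (@squeeze_cvgr _ _ _ _ (cst 0) (fun i => D * i.+1%:R^-1)).
- near=> i; rewrite normr_ge0/= ler_pdivlMr// -hu -normrM mulrC mulrA -exprS.
  apply: le_trans (hC _) _; apply: ler_wpM2l => //.
  exact: normal_pdf_ub.
- exact: cvg_cst.
- rewrite -[X in _ --> X](mulr0 D); apply: cvgMr.
  exact: cvg_harmonic.
Unshelve. all: by end_near. Qed.


Lemma is_derive_normal_pdf (x : R) : is_derive x 1 phi (- x * phi x).
Proof.
have dE : is_derive x 1 (fun y : R => - (y ^+ 2 / 2)) (- x).
  apply: is_derive_eq.
  by rewrite /GRing.scale/=; field.
have -> : phi = (fun y => normal_peak 1 * expR (- (y ^+ 2 / 2))).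
  by apply/funext => y; exact: normal_pdf01E.
apply: is_derive_eq.
by rewrite /GRing.scale/=; ring.
Qed.

(** The integrand difference is the derivative of x^n phi(x), since phi' = -x phi. For n = 0 the
    value of [n.-1] is harmless because its factor is 0. *)
Lemma integral_normal_pdf_stein n :
  (\int[mu]_x (x ^+ n.+1 * phi x)%:E =
   n%:R%:E * \int[mu]_x (x ^+ n.-1 * phi x)%:E)%E.
Proof.
pose f (x : R) := n%:R * (x ^+ n.-1 * phi x) - x ^+ n.+1 * phi x.
have : (\int[mu]_x (f x)%:E = 0)%E.
  apply: (@integral_derive_eq0 (fun x => x ^+ n * phi x)).
  - move=> x; rewrite /f; have dphi := is_derive_normal_pdf x.
    have dX := is_derive_poly 'X^n x.
    have -> : (fun y : R => y ^+ n * phi y) = (fun y => 'X^n.[y] * phi y).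
      by apply/funext => y; rewrite hornerXn.
    apply: (is_derive_eq (is_deriveM dX dphi)).
    by rewrite /GRing.scale/= derivXn hornerMn !hornerXn exprS -mulr_natl; ring.
  - move=> x; apply: cvgB; last exact: continuous_exprn_normal_pdf.
    by apply: cvgMr; exact: continuous_exprn_normal_pdf.
  - have -> : EFin \o f = ((fun x => n%:R%:E * (x ^+ n.-1 * phi x)%:E) \-
        (fun x => (x ^+ n.+1 * phi x)%:E))%E.
      by apply/funext => x; rewrite /= EFinB EFinM.
    apply: integrableB => //; last exact: integrable_exprn_normal_pdf.
    by apply: integrableZl => //; exact: integrable_exprn_normal_pdf.
  - by apply: cvg_exprn_normal_pdf => i; rewrite normr_nat.
  - by apply: cvg_exprn_normal_pdf => i; rewrite normrN normr_nat.
under eq_integral do rewrite /f EFinB EFinM.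
rewrite integralB//=; last 2 first.
- by apply: integrableZl => //; exact: integrable_exprn_normal_pdf.
- exact: integrable_exprn_normal_pdf.
rewrite integralZl//; last exact: integrable_exprn_normal_pdf.
move/eqP; rewrite sube_eq ?add0e.
- by move/eqP.
- by rewrite fin_numM// integrable_fin_num//; exact: integrable_exprn_normal_pdf.
- rewrite fin_num_adde_defl// integrable_fin_num//.
  exact: integrable_exprn_normal_pdf.
Qed.

Lemma measurable_exprn n : measurable_fun setT (fun x : R => x ^+ n).
Proof. exact: measurable_funX. Qed.

Lemma integrable_normal_exprn n :
  (std_normal R).-integrable setT (fun x : R => (x ^+ n)%:E).
Proof.
apply: integrable_normal_prob; first exact: measurable_exprn.
exact: integrable_exprn_normal_pdf.
Qed.

Lemma normal_momentE n :
  ((normal_moment R n)%:E = \int[mu]_x (x ^+ n * phi x)%:E)%E.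
Proof.
rewrite /normal_moment unlock integral_normal_prob; last exact: measurable_exprn.
by rewrite fineK// integrable_fin_num//; exact: integrable_exprn_normal_pdf.
Qed.

Lemma normal_moment0 : normal_moment R 0 = 1.
Proof.
apply: EFin_inj; rewrite normal_momentE.
by under eq_integral do rewrite expr0 mul1r; exact: integral_normal_pdf.
Qed.

Lemma normal_momentS n : normal_moment R n.+1 = n%:R * normal_moment R n.-1.
Proof.
apply: EFin_inj.
by rewrite EFinM !normal_momentE integral_normal_pdf_stein.
Qed.

Lemma normal_moment_odd n : odd n -> normal_moment R n = 0.
Proof.
elim/ltn_ind: n => -[//|[|n]] ih on; first by rewrite normal_momentS mul0r.
by rewrite normal_momentS ih ?mulr0//; move: on; rewrite /= negbK.
Qed.

(** The density is even, so [0, +oo[ has mass 1/2; the endpoint is null, and the complement of ]0,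
    +oo[ is the half-line wanted. *)
Lemma dcdf_std_normal0 : dcdf (std_normal R) 0 = 1 / 2.
Proof.
have mphi := measurable_normal_pdf (0 : R) 1.
have := integral_normal_pdf (0 : R) 1.
rewrite ge0_symfun_integralT; first last.
- by move=> x /=; rewrite !normal_pdf01E sqrrN.
- by apply: continuous_normal_pdf; exact: oner_neq0.
- exact: normal_pdf_ge0.
rewrite -set_itvcy => h.
have hN : (std_normal R [set` `[0%R, +oo[] = (1 / 2)%:E)%E.
  have ff : std_normal R [set` `[0%R, +oo[] \is a fin_num.
    by apply: fin_num_measure; exact: measurable_itv.
  rewrite -(fineK ff); congr EFin; apply: (mulfI (_ : 2 != 0)) => //.
  rewrite mulrCA divff// mulr1.
  by apply: EFin_inj; rewrite EFinM fineK.
have hN' : (std_normal R [set` `]0%R, +oo[] = (1 / 2)%:E)%E.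
  rewrite -hN /std_normal /normal_prob; apply: integral_itv_obnd_cbnd.
  exact/measurable_EFinP/measurable_funTS.
have := @probability_setC _ _ _ (std_normal R) [set` `]0, +oo[] (measurable_itv _).
rewrite /dcdf setCitvr hN' => ->.
by rewrite -EFinB/=; lra.
Qed.

End normal_moments.

(** * Expectations of polynomials *)

Section polynomial_expectation.
Context {R : realType}.
Implicit Types (P : real_distribution R) (q h : {poly R}).

Definition expect_poly P q : R := \int[P]_x q.[x].

Lemma horner_sum_coef n q : (size q <= n)%N ->
  (fun x : R => q.[x]%:E) = (fun x => \sum_(i < n) (q`_i)%:E * (x ^+ i)%:E)%E.
Proof.
move=> qn; apply/funext => x; rewrite (horner_coef_wide _ qn) -sumEFin.
by apply: eq_bigr => i _; rewrite EFinM.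
Qed.

Lemma integrable_horner P n q :
  (forall i, (i < n)%N -> P.-integrable setT (fun x : R => (x ^+ i)%:E)) ->
  (size q <= n)%N -> P.-integrable setT (fun x : R => q.[x]%:E).
Proof.
move=> iP qn; rewrite (horner_sum_coef qn).
by apply: integrable_sum => // i _; apply: integrableZl => //; exact: iP.
Qed.

Lemma expect_polyE P n q :
  (forall i, (i < n)%N -> P.-integrable setT (fun x : R => (x ^+ i)%:E)) ->
  (size q <= n)%N -> expect_poly P q = \sum_(i < n) q`_i * expect_poly P 'X^i.
Proof.
move=> iP qn; apply: EFin_inj.
rewrite /expect_poly /Rintegral fineK; last first.
  by apply: integrable_fin_num => //; exact: integrable_horner iP qn.
rewrite (horner_sum_coef qn) integral_sum//; last first.
  by move=> i; apply: integrableZl => //; exact: iP.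
rewrite -sumEFin; apply: eq_bigr => i _.
rewrite integralZl//; last exact: iP.
under [X in _ = (_ * fine X)%:E]eq_integral do rewrite hornerXn.
by rewrite EFinM fineK//; apply: integrable_fin_num => //; exact: iP.
Qed.

Local Notation gmean := (expect_poly (std_normal R)).

Lemma integrable_normal_horner q :
  (std_normal R).-integrable setT (fun x : R => q.[x]%:E).
Proof.
by apply: integrable_horner (leqnn _) => i _; exact: integrable_normal_exprn.
Qed.

Lemma gmeanXn n : gmean 'X^n = normal_moment R n.
Proof.
rewrite /expect_poly /Rintegral /normal_moment.
by under eq_integral do rewrite hornerXn; rewrite unlock.
Qed.

Lemma gmeanE n q : (size q <= n)%N ->
  gmean q = \sum_(i < n) q`_i * normal_moment R i.
Proof.
move=> qn; rewrite (@expect_polyE _ n)//; last first.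
  by move=> i _; exact: integrable_normal_exprn.
by apply: eq_bigr => i _; rewrite gmeanXn.
Qed.

Lemma gmean_is_linear : linear (gmean : {poly R} -> R^o).
Proof.
move=> a p q.
pose n := maxn (size p) (size q).
have sp : (size p <= n)%N by exact: leq_maxl.
have sq : (size q <= n)%N by exact: leq_maxr.
have sr : (size (a *: p + q)%R <= n)%N.
  rewrite (leq_trans (size_polyD _ _))// geq_max sq andbT.
  by rewrite (leq_trans (size_scale_leq _ _)).
rewrite (gmeanE sp) (gmeanE sq) (gmeanE sr) scaler_sumr -big_split.
by apply: eq_bigr => i _; rewrite coefD coefZ mulrDl -mulrA.
Qed.

HB.instance Definition _ :=
  GRing.isLinear.Build R {poly R} R^o _ gmean gmean_is_linear.

Lemma gmeanZ a q : gmean (a *: q) = a * gmean q.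
Proof. by rewrite linearZ. Qed.

Lemma gmean1 : gmean 1 = 1.
Proof. by rewrite -(expr0 'X) gmeanXn normal_moment0. Qed.

(** Gaussian integration by parts; on monomials it is the moment recursion. *)
Lemma gmean_mulX q : gmean ('X * q) = gmean q^`().
Proof.
rewrite -[q]coefK poly_def mulr_sumr !raddf_sum/=; apply: eq_bigr => i _.
rewrite -scalerAr derivZ !gmeanZ -exprS derivXn -scaler_nat gmeanZ.
by rewrite !gmeanXn normal_momentS.
Qed.

Lemma expect_poly_matching k P q : matches_even_normal_moments k P ->
  (size q <= (2 * k).+1)%N ->
  P.-integrable setT (fun x : R => q.[x]%:E) /\ expect_poly P q = gmean q.
Proof.
move=> mP sq.
have iP i : (i < (2 * k).+1)%N -> P.-integrable setT (fun x : R => (x ^+ i)%:E).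
  case: i => [_|i ik]; last by have [] := mP i.+1 ik.
  under eq_fun do rewrite expr0.
  exact: finite_measure_integrable_cst.
split; first exact: integrable_horner iP sq.
(* The matching hypothesis starts at order 1; order 0 is the total mass. *)
rewrite (expect_polyE iP sq) (gmeanE sq); apply: eq_bigr => -[[|i] ik] _ /=.
  congr *%R; rewrite normal_moment0 /expect_poly expr0.
  under eq_Rintegral do rewrite hornerC.
  by rewrite Rintegral_cst// mul1r [X in fine X](probability_setT P).
congr *%R; have [_] := mP i.+1 ik.
rewrite /expect_poly /Rintegral => h.
by under eq_integral do rewrite hornerXn; move: h; rewrite unlock => ->.
Qed.

(** A zero mean would make h vanish almost everywhere, but the roots of h form a finite set, which
    is null for the normal law. *)
Lemma gmean_gt0 h : (forall x, 0 <= h.[x]) -> h != 0 -> 0 < gmean h.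
Proof.
move=> h0 hn0; rewrite lt_neqAle Rintegral_ge0// andbT eq_sym; apply/eqP => gh.
have mh : measurable_fun setT (fun x : R => h.[x]%:E).
  exact: measurable_int (integrable_normal_horner h).
have : (\int[std_normal R]_x `|h.[x]%:E| = 0)%E.
  rewrite -[RHS]/(0%:E) -gh fineK; last first.
    by apply: integrable_fin_num => //; exact: integrable_normal_horner.
  by apply: eq_integral => x _; rewrite gee0_abs// lee_fin.
move=> /(ae_eq_integral_abs (std_normal R) measurableT mh) neg.
pose A := [set x : R | root h x].
have cA : countable A.
  apply: finite_set_countable; apply: (@sub_finite_set _ _ [set` rootsR h]).
    by move=> x /= hx; rewrite -(roots_on_rootsR hn0) in_itv.
  exact: finite_seq.
have mA : measurable (A : set (measurableTypeR R)).
  exact: countable_measurable.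
have A0 : std_normal R A = 0%E.
  apply: (null_content_dominatesP _ _).1 (normal_prob_dominates 0 1) _ mA _.
  exact: countable_lebesgue_measure0.
have : (std_normal R).-negligible setT.
  rewrite -(setvU A); apply: negligibleU; last by exists A; split.
  apply: negligibleS neg => x /= nA hx; apply: nA.
  by apply/rootP/EFin_inj; exact: hx.
move=> /(negligibleP (std_normal R) measurableT) N0.
have := probability_setT (std_normal R).
by rewrite [LHS]N0 => /esym/eqP; rewrite onee_eq0.
Qed.

End polynomial_expectation.

(** * Hermite polynomials *)

Section hermite_polynomials.
Context {R : realType}.
Implicit Types q h : {poly R}.
Local Notation gmean := (expect_poly (std_normal R)).

Lemma size_hermite n : size (hermite R n) = n.+1 /\ hermite R n \is monic.
Proof.
elim: n => [|n [sH mH]] /=; first by rewrite size_poly1 monic1.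
have H0 : hermite R n != 0 by rewrite -size_poly_eq0 sH.
have sX : size ('X * hermite R n) = n.+2 by rewrite mulrC size_mulX// sH.
have lt : (size (- (hermite R n)^`())%R < size ('X * hermite R n)%R)%N.
  by rewrite sX size_polyN -sH ltnS ltnW// lt_size_deriv.
by rewrite size_polyDl// sX monicE lead_coefDl// mulrC lead_coefMX -monicE.
Qed.

(** The recursion and [gmean_mulX] give E[He_(n+1) q] = E[He_n q'], and each step lowers the degree
    of q. *)
Lemma hermite_orthogonal n q : (size q <= n)%N -> gmean (hermite R n * q) = 0.
Proof.
elim: n q => [|n IHn] q sq /=.
  by move: sq; rewrite size_poly_leq0 => /eqP ->; rewrite mulr0 raddf0.
rewrite mulrBl raddfB/= -mulrA gmean_mulX derivM raddfD/=.
rewrite addrAC subrr add0r IHn//.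
have [->|q0] := eqVneq q 0; first by rewrite deriv0 size_poly0.
by rewrite -ltnS (leq_trans (lt_size_deriv q0)).
Qed.

Lemma hermite_parity n x : (hermite R n).[- x] = (-1) ^+ n * (hermite R n).[x].
Proof.
(* The induction runs on a polynomial identity, not on values, because the recursion needs its
   derivative. *)
have : hermite R n \Po (- 'X) = (-1) ^+ n *: hermite R n.
  elim: n => [|n IHn] /=; first by rewrite comp_polyC expr0 scale1r.
  have := congr1 deriv IHn; rewrite deriv_comp derivN derivX mulrN1 derivZ => /eqP.
  rewrite eqr_oppLR => /eqP IHd.
  rewrite comp_polyB comp_polyM comp_polyX IHn IHd exprS mulN1r.
  by rewrite opprK -scalerAr mulNr scalerN scaleNr scalerBr opprB addrC.
by move=> /(congr1 (fun p => p.[x])); rewrite horner_comp hornerZ !hornerE.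
Qed.

Lemma poly_no_root_semidefinite q : (forall x, ~~ root q x) ->
  (forall x, 0 <= q.[x]) \/ (forall x, 0 <= (- q).[x]).
Proof.
move=> nr; have [q0|q0] := leP 0 q.[0]; [left|right] => x; last first.
  rewrite hornerN oppr_ge0 leNgt; apply/negP => qx.
  have [x0|x0] := leP 0 x.
    have [|y _ ry] := @poly_ivt _ q 0 x x0; last by have := nr y; rewrite ry.
    by rewrite !ltW.
  have [|y _ ry] := @poly_ivt _ (- q) x 0 (ltW x0).
    by rewrite !hornerN oppr_le0 oppr_ge0 !ltW.
  by have := nr y; rewrite -rootN ry.
rewrite leNgt; apply/negP => qx.
have [x0|x0] := leP 0 x.
  have [|y _ ry] := @poly_ivt _ (- q) 0 x x0.
    by rewrite !hornerN oppr_le0 oppr_ge0 q0 ltW.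
  by have := nr y; rewrite -rootN ry.
have [|y _ ry] := @poly_ivt _ q x 0 (ltW x0); first by rewrite q0 ltW.
by have := nr y; rewrite ry.
Qed.

(** [s] lists the roots of odd multiplicity. Roots are split off one by one; a root already in [s]
    leaves it, and its square goes into the semidefinite factor [h]. *)
Lemma poly_sign_change_factor q : q != 0 -> exists s h,
  [/\ uniq s, q = \prod_(a <- s) ('X - a%:P) * h &
      (forall x, 0 <= h.[x]) \/ (forall x, 0 <= (- h).[x])].
Proof.
have [n] := ubnP (size q); elim: n q => // n IHn q sq q0.
have [[a /factor_theorem[g qg]]|nr] := pselect (exists a, root q a); last first.
  exists [::], q; split=> //; first by rewrite big_nil mul1r.
  by apply: poly_no_root_semidefinite => x; apply/negP => rx; apply: nr; exists x.
have g0 : g != 0 by apply: contraNneq q0 => g0; rewrite qg g0 mul0r.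
have sg : (size g < n)%N.
  by move: sq; rewrite qg size_Mmonic ?monicXsubC// size_XsubC addn2.
have [s [h [us gE sh]]] := IHn g sg g0.
have [as_|nas] := boolP (a \in s); last first.
  exists (a :: s), h; split=> //=; first by rewrite nas.
  by rewrite big_cons qg gE mulrC mulrA.
exists (rem a s), (('X - a%:P) ^+ 2 * h); split; first exact: rem_uniq.
  rewrite qg gE (big_rem a as_)/=; ring.
case: sh => sh; [left|right] => x.
  by rewrite hornerM mulr_ge0// horner_exp sqr_ge0.
by rewrite -mulrN hornerM mulr_ge0// horner_exp sqr_ge0.
Qed.

(* If q, the product over the sign changes of He_n, had degree less than n,
   orthogonality would give E[He_n q] = 0 although He_n q has constant sign. *)
Lemma hermite_roots n : exists s : seq R,
  [/\ uniq s, size s = n & forall x, root (hermite R n) x = (x \in s)].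
Proof.
have [sH mH] := size_hermite n.
have H0 : hermite R n != 0 by exact: monic_neq0.
have [s [h [us HE sh]]] := poly_sign_change_factor H0.
set q := \prod_(a <- s) ('X - a%:P) in HE.
have q0 : q != 0 by apply: contraNneq H0 => q0; rewrite HE q0 mul0r.
have h0 : h != 0 by apply: contraNneq H0 => h0; rewrite HE h0 mulr0.
have rs : all (root (hermite R n)) s.
  by apply/allP => a as_; rewrite HE rootM root_prod_XsubC as_.
have ss : size s = n.
  apply/eqP; rewrite eqn_leq -ltnS -sH max_poly_roots// leqNgt; apply/negP => sn.
  have : gmean (hermite R n * q) = 0.
    by apply: hermite_orthogonal; rewrite size_prod_XsubC.
  rewrite HE (_ : q * h * q = q ^+ 2 * h); last by ring.
  have q2h : q ^+ 2 * h != 0 by rewrite mulf_neq0// expf_neq0.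
  case: sh => sh.
    have : 0 < gmean (q ^+ 2 * h).
      apply: gmean_gt0 => // x.
      by rewrite hornerM horner_exp mulr_ge0// sqr_ge0.
    by move=> /[swap] ->; rewrite ltxx.
  have : 0 < gmean (- (q ^+ 2 * h)).
    apply: gmean_gt0; last by rewrite oppr_eq0.
    by move=> x; rewrite -mulrN hornerM horner_exp mulr_ge0// sqr_ge0.
  by rewrite raddfN/= => /[swap] ->; rewrite oppr0 ltxx.
exists s; split=> // x.
have -> : hermite R n = q.
  rewrite [LHS](@all_roots_prod_XsubC _ _ s); last 3 first.
  - by rewrite sH ss.
  - exact: rs.
  - by rewrite uniq_rootsE.
  by rewrite (monicP mH) scale1r.
by rewrite root_prod_XsubC.
Qed.

Lemma hermite_odd_root m x :
  root (hermite R m.*2.+1) (- x) = root (hermite R m.*2.+1) x.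
Proof.
by rewrite /root hermite_parity mulf_eq0 expf_eq0 oppr_eq0 oner_eq0 andbF.
Qed.

Lemma hermite_odd_root0 m : root (hermite R m.*2.+1) 0.
Proof.
have := hermite_parity m.*2.+1 0.
rewrite oppr0 -signr_odd/= odd_double/= expr1 mulN1r => /eqP.
by rewrite -addr_eq0 -mulr2n mulrn_eq0.
Qed.

(** By parity the 2m+1 roots are 0, the positive ones and their opposites, so exactly m are
    positive; their squares are the nodes. *)
Lemma hermite_odd_enum_sq m : exists y : 'I_m -> R,
  enum_sq_nonzero_roots (hermite R m.*2.+1) y.
Proof.
have [s [us ss rs]] := hermite_roots m.*2.+1.
pose sp := [seq x <- s | 0 < x].
have usp : uniq sp by exact: filter_uniq.
have spE x : (x \in sp) = (0 < x) && root (hermite R m.*2.+1) x.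
  by rewrite mem_filter rs.
have ssp : size sp = m.
  have : perm_eq s (0 :: sp ++ map -%R sp).
    apply: uniq_perm => //=.
      rewrite mem_cat spE ltxx/= cat_uniq usp map_inj_uniq ?usp ?andbT/=; last first.
        exact: oppr_inj.
      apply/andP; split.
        apply/mapP => -[x]; rewrite spE => /andP[x0 _] /eqP.
        by rewrite eq_sym oppr_eq0 gt_eqF.
      apply/hasPn => _ /mapP[x + ->]; rewrite !spE => /andP[x0 _].
      by rewrite oppr_gt0 ltNge ltW.
    move=> x; rewrite inE mem_cat -rs.
    have -> : (x \in map -%R sp) = (x < 0) && root (hermite R m.*2.+1) x.
      rewrite -{1}[x]opprK mem_map; last exact: oppr_inj.
      by rewrite spE oppr_gt0 hermite_odd_root.
    rewrite spE; case: (ltgtP x 0) => [x0|x0|->]; rewrite ?orbF //=.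
    by rewrite hermite_odd_root0.
  move=> /perm_size; rewrite ss /= size_cat size_map addnn => -[].
  by move=> /double_inj.
pose y (i : 'I_m) := (nth 0 sp i) ^+ 2.
have spi (i : 'I_m) : nth 0 sp i \in sp by rewrite mem_nth// ssp.
exists y; split=> [i j|t].
  rewrite /y => /eqP; rewrite eqrXn2//; first 1 last.
  - by have := spi i; rewrite spE => /andP[/ltW].
  - by have := spi j; rewrite spE => /andP[/ltW].
  by rewrite nth_uniq ?ssp// => /eqP /val_inj.
split=> [[i <-]|[x [x0 rx <-]]].
  have := spi i; rewrite spE => /andP[x0 rx].
  by exists (nth 0 sp i); rewrite gt_eqF.
have xsp : `|x| \in sp.
  by rewrite spE normr_gt0 x0/=; have [_|_] := ger0P x; rewrite ?hermite_odd_root.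
have ix : (index `|x|%R sp < m)%N by rewrite -ssp index_mem.
by exists (Ordinal ix); rewrite /y/= nth_index// real_normK// num_real.
Qed.

End hermite_polynomials.

(** * Gauss-Hermite quadrature and the Hankel matrix *)

Section gauss_hermite_quadrature.
Context {R : realType} (m : nat) (y : 'I_m -> R).
Hypothesis y_enum : enum_sq_nonzero_roots (hermite R m.*2.+1) y.
Implicit Types (q g : {poly R}) (i j : 'I_m).
Local Notation gmean := (expect_poly (std_normal R)).

Definition node_poly : {poly R} := \prod_i ('X - (y i)%:P).

Lemma node_inj : injective y.
Proof. by have [] := y_enum. Qed.

Lemma node_gt0 i : 0 < y i.
Proof.
have [_ h] := y_enum; have [x [x0 _ <-]] := (h (y i)).1 (ex_intro _ i erefl).
by rewrite exprn_even_gt0.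
Qed.

Lemma root_hermite_sqrt_node i : root (hermite R m.*2.+1) (Num.sqrt (y i)).
Proof.
have [_ h] := y_enum; have [x [x0 rx <-]] := (h (y i)).1 (ex_intro _ i erefl).
by rewrite sqrtr_sqr; have [_|_] := ger0P x; rewrite ?hermite_odd_root.
Qed.

Lemma size_node_poly : size node_poly = m.+1.
Proof. by rewrite size_prod_XsubC /index_enum -enumT size_enum_ord. Qed.

Lemma node_poly_monic : node_poly \is monic.
Proof. exact: monic_prod_XsubC. Qed.

Lemma horner_node_poly t : node_poly.[t] = \prod_i (t - y i).
Proof. by rewrite horner_prod; apply: eq_bigr => i _; rewrite hornerXsubC. Qed.

Lemma node_poly_root i : node_poly.[y i] = 0.
Proof. by rewrite horner_node_poly (bigD1 i)//= subrr mul0r. Qed.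

Lemma node_poly0_neq0 : node_poly.[0] != 0.
Proof.
rewrite horner_node_poly prodf_seq_neq0; apply/allP => i _ /=.
by rewrite sub0r oppr_eq0 gt_eqF// node_gt0.
Qed.

Lemma horner_comp_sqr g x : (g \Po 'X^2).[x] = g.[x ^+ 2].
Proof. by rewrite horner_comp hornerXn. Qed.

Lemma node_poly_root_eq0 g : (size g <= m)%N -> (forall i, g.[y i] = 0) -> g = 0.
Proof.
move=> sg g0; apply: (@roots_geq_poly_eq0 _ _ [seq y i | i : 'I_m]).
- by apply/allP => _ /mapP[i _ ->]; apply/rootP.
- by rewrite map_inj_uniq ?enum_uniq//; exact: node_inj.
- by rewrite size_map size_enum_ord.
Qed.

(** Both sides are monic of degree 2m+1 with the 2m+1 distinct roots 0 and +-sqrt(y_i). *)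
Lemma hermite_node_poly : hermite R m.*2.+1 = 'X * (node_poly \Po 'X^2).
Proof.
have [sH mH] := @size_hermite R m.*2.+1.
pose s := [seq Num.sqrt (y i) | i : 'I_m].
have ss : size s = m by rewrite size_map size_enum_ord.
have s0 x : x \in s -> 0 < x.
  by move=> /mapP[i _ ->]; rewrite sqrtr_gt0 node_gt0.
have us : uniq s.
  rewrite map_inj_uniq ?enum_uniq// => i j /(congr1 (fun x => x ^+ 2)).
  by rewrite !sqr_sqrtr ?ltW ?node_gt0// => /node_inj.
have rs : all (root (hermite R m.*2.+1)) s.
  by apply/allP => _ /mapP[i _ ->]; exact: root_hermite_sqrt_node.
have ops x : (x \in map -%R s) = (- x \in s).
  by rewrite -{1}[x]opprK mem_map//; exact: oppr_inj.
rewrite [LHS](@all_roots_prod_XsubC _ _ (0 :: s ++ map -%R s)); last 3 first.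
- by rewrite sH /= size_cat size_map ss addnn.
- rewrite /= hermite_odd_root0 all_cat rs /=; apply/allP => x; rewrite ops => sx.
  by rewrite -hermite_odd_root (allP rs).
- rewrite uniq_rootsE /= cat_uniq us map_inj_uniq ?us ?andbT/=; last first.
    exact: oppr_inj.
  rewrite mem_cat ops oppr0 orbb; apply/andP; split.
    by apply/negP => /s0; rewrite ltxx.
  apply/hasPn => x; rewrite ops => /s0; rewrite oppr_gt0 => x0.
  by apply/negP => /s0/ltW; rewrite leNgt x0.
rewrite (monicP mH) scale1r big_cons subr0 big_cat/= big_map; congr (_ * _).
rewrite -big_split/= /s big_image/= /node_poly rmorph_prod/=.
apply: eq_bigr => i _.
rewrite comp_polyB comp_polyX comp_polyC -[in RHS](sqr_sqrtr (ltW (node_gt0 i))).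
by rewrite polyCN rmorphXn/=; ring.
Qed.

(** Mean under the law of Z^2. In the variable t = x^2 the symmetric nodes fold together and the
    even normal moments become the moments of one law on [0, +oo[. *)
Definition emean g := gmean (g \Po 'X^2).

Lemma emean_is_linear : linear (emean : {poly R} -> R^o).
Proof. by move=> a p q; rewrite /emean raddfD/= linearZ/= linearP. Qed.

HB.instance Definition _ :=
  GRing.isLinear.Build R {poly R} R^o _ emean emean_is_linear.

Lemma emeanZ a g : emean (a *: g) = a * emean g.
Proof. by rewrite linearZ. Qed.

Lemma emeanXn (j : nat) : emean 'X^j = normal_moment R (2 * j).
Proof. by rewrite /emean comp_Xn_poly -exprM gmeanXn. Qed.

Lemma emeanC a : emean a%:P = a.
Proof. by rewrite /emean comp_polyC -[a%:P]mulr1 mul_polyC gmeanZ gmean1 mulr1. Qed.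

Lemma emean_gt0 g : (forall t, 0 <= t -> 0 <= g.[t]) -> g != 0 -> 0 < emean g.
Proof.
move=> g0 gn0; apply: gmean_gt0.
  by move=> x; rewrite horner_comp_sqr g0// sqr_ge0.
by rewrite comp_poly_eq0 ?size_polyXn.
Qed.

(** With W = [node_poly], x^2 W(x^2) g(x^2) = He_(2m+1)(x) x g(x^2), whose last factor x g(x^2) has
    degree below 2m+1. Thus W is orthogonal for the law of Z^2 weighted by t. *)
Lemma emean_node_poly_orthogonal g : (size g <= m)%N ->
  emean ('X * (node_poly * g)) = 0.
Proof.
move=> sg; have [->|g0] := eqVneq g 0; first by rewrite !mulr0 raddf0.
rewrite /emean !comp_polyM comp_polyX mulrA.
rewrite [X in X * _](_ : _ = 'X * hermite R m.*2.+1).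
  rewrite -mulrA mulrCA hermite_orthogonal//.
  rewrite mulrC size_mulX ?comp_poly_eq0 ?size_polyXn//.
  rewrite ltnS (leq_trans (size_comp_poly_leq _ _))// size_polyXn/=.
  by rewrite muln2 ltn_double; rewrite prednK// size_poly_gt0.
by rewrite hermite_node_poly expr2 mulrA.
Qed.

Definition lagrange i : {poly R} :=
  (\prod_(j | j != i) (y i - y j)^-1) *: \prod_(j | j != i) ('X - (y j)%:P).

Lemma size_lagrange_le i : (size (lagrange i) <= m)%N.
Proof.
apply: leq_trans (size_scale_leq _ _) _.
have := size_node_poly; rewrite /node_poly (bigD1 i)//= size_Mmonic.
- by rewrite size_XsubC add2n/= => -[->].
- by rewrite polyXsubC_eq0.
- by apply: monic_prod => j _; exact: monicXsubC.
Qed.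

Lemma lagrange_node i j : (lagrange i).[y j] = (i == j)%:R.
Proof.
rewrite hornerZ horner_prod; have [<-|ij] := eqVneq i j.
  rewrite -big_split big1//= => l li; rewrite hornerXsubC mulVf// subr_eq0.
  by apply: contra_neq li => /node_inj.
rewrite [X in _ * X](bigD1 j)/= 1?eq_sym// hornerXsubC subrr mul0r mulr0//.
Qed.

Lemma lagrange_interpolation g : (size g <= m)%N ->
  g = \sum_i g.[y i] *: lagrange i.
Proof.
move=> sg; apply/eqP; rewrite -subr_eq0; apply/eqP/node_poly_root_eq0.
  rewrite (leq_trans (size_polyD _ _))// geq_max sg size_polyN.
  apply: (leq_trans (size_sum _ _ _)); apply/bigmax_leqP => i _.
  by rewrite (leq_trans (size_scale_leq _ _))// size_lagrange_le.
move=> j; rewrite hornerD hornerN horner_sum (bigD1 j)//= big1 => [|i ij].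
  by rewrite hornerZ lagrange_node eqxx mulr1 addr0 subrr.
by rewrite hornerZ lagrange_node (negbTE ij) mulr0.
Qed.

Definition moment_weights (p : 'I_m -> R) := forall j : nat, (1 <= j <= m)%N ->
  \sum_(i < m) p i * y i ^+ j = normal_moment R (2 * j) / 2.

(** The value forced by testing the quadrature on t times the Lagrange polynomial: 2 counts the two
    points +-sqrt(y_i), and y_i undoes the factor t. *)
Definition gauss_weight i := emean ('X * lagrange i) / (2 * y i).

(** For 1 <= j <= m, t^(j-1) equals its own Lagrange interpolant. *)
Lemma gauss_weight_moment : moment_weights gauss_weight.
Proof.
move=> j /andP[]; case: j => // j _ jm; rewrite -emeanXn exprS.
rewrite [X in 'X * X]lagrange_interpolation ?size_polyXn//.
rewrite mulr_sumr raddf_sum/= mulr_suml; apply: eq_bigr => i _.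
rewrite -scalerAr emeanZ hornerXn /gauss_weight exprS.
by field; rewrite gt_eqF// node_gt0.
Qed.

Section weights.
Variable p : 'I_m -> R.
Hypothesis p_moment : moment_weights p.

(** On monomials this is the weight system; the factor ['X] reflects that its powers start at 1. *)
Lemma emean_mulX_quadrature_lt g : (size g <= m)%N ->
  emean ('X * g) = \sum_i 2 * p i * y i * g.[y i].
Proof.
move=> sg; rewrite -{1}(coefK g) poly_def mulr_sumr raddf_sum/=.
transitivity (\sum_(j < size g) g`_j * \sum_i 2 * p i * y i ^+ j.+1).
  apply: eq_bigr => j _; rewrite -scalerAr emeanZ -(exprS 'X j) emeanXn.
  congr (_ * _).
  have jm : (1 <= j.+1 <= m)%N by rewrite /= (leq_trans (ltn_ord j)).
  under eq_bigr do rewrite -mulrA.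
  by rewrite -mulr_sumr (p_moment jm); field.
under [LHS]eq_bigr => j _ do rewrite mulr_sumr.
rewrite exchange_big/=; apply: eq_bigr => i _.
rewrite (horner_coef g) mulr_sumr; apply: eq_bigr => j _.
by rewrite exprS; ring.
Qed.

Lemma moment_weights_unique i : p i = gauss_weight i.
Proof.
rewrite /gauss_weight emean_mulX_quadrature_lt ?size_lagrange_le//.
rewrite (bigD1 i)//= big1 => [|j ji]; last first.
  by rewrite lagrange_node eq_sym (negbTE ji) mulr0.
by rewrite lagrange_node eqxx /=; field; rewrite gt_eqF// node_gt0.
Qed.

(** Gauss's doubling of the degree: after division by [node_poly] the quotient term vanishes by
    orthogonality, and the remainder has degree below m and the values of g at the nodes. *)
Lemma emean_mulX_quadrature g : (size g <= m.*2)%N ->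
  emean ('X * g) = \sum_i 2 * p i * y i * g.[y i].
Proof.
move=> sg.
have W0 : node_poly != 0 by exact: monic_neq0 node_poly_monic.
rewrite {1}(divp_eq g node_poly) mulrDr raddfD/= [_ %/ _ * _]mulrC.
rewrite emean_node_poly_orthogonal ?add0r; last first.
  by rewrite size_divp// size_node_poly/= leq_subLR addnn.
rewrite emean_mulX_quadrature_lt; last first.
  by rewrite -ltnS -size_node_poly ltn_modp.
apply: eq_bigr => i _; congr (_ * _).
rewrite [in RHS](divp_eq g node_poly) hornerD hornerM node_poly_root mulr0.
by rewrite add0r.
Qed.

(** Write g = t h + g(0). The previous rule handles t h, and the mass at zero is what makes the rule
    exact on constants. *)
Lemma emean_quadrature g : (size g <= m.*2.+1)%N ->
  emean g = mass_at_zero p * g.[0] + \sum_i 2 * p i * g.[y i].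
Proof.
move=> sg.
have /factor_theorem[h gh] : root (g - (g.[0])%:P) 0.
  by rewrite /root !hornerE subrr.
have {}gh : g = 'X * h + (g.[0])%:P.
  by rewrite mulrC -[X in h * X](subr0 'X) -polyC0 -gh subrK.
have sh : (size h <= m.*2)%N.
  have [->|h0] := eqVneq h 0; first by rewrite size_poly0.
  rewrite -ltnS -(size_mulX h0) mulrC (_ : 'X * h = g - (g.[0])%:P).
    rewrite (leq_trans (size_polyD _ _))// geq_max sg size_polyN.
    by rewrite (leq_trans (size_polyC_leq1 _)).
  by rewrite {1}gh addrK.
rewrite {1}gh raddfD/= emeanC (emean_mulX_quadrature sh) /mass_at_zero.
have gy i : g.[y i] = y i * h.[y i] + g.[0].
  by rewrite {1}gh hornerD hornerM hornerX hornerC.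
under [in RHS]eq_bigr => i _ do rewrite gy mulrDr mulrA.
rewrite big_split/= -mulr_suml -mulr_sumr; ring.
Qed.

(** Test on t times the squared Lagrange polynomial: its mean is positive, and node i alone
    contributes, giving 2 p_i y_i. *)
Lemma weight_gt0 i : 0 < p i.
Proof.
have yi := node_gt0 i.
have l0 : lagrange i != 0.
  apply/eqP => l0; have := lagrange_node i i.
  by rewrite l0 horner0 eqxx => /esym/eqP; rewrite oner_eq0.
have : 0 < emean ('X * lagrange i ^+ 2).
  apply: emean_gt0; last by rewrite mulf_neq0 ?polyX_eq0// expf_neq0.
  by move=> t t0; rewrite hornerM hornerX horner_exp mulr_ge0// sqr_ge0.
rewrite emean_mulX_quadrature.
  rewrite (bigD1 i)//= big1 => [|j ji]; last first.
    by rewrite horner_exp lagrange_node eq_sym (negbTE ji) expr0n mulr0.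
  rewrite horner_exp lagrange_node eqxx expr1n mulr1 addr0.
  by rewrite pmulr_lgt0// pmulr_rgt0.
rewrite expr2 (leq_trans (size_polyMleq _ _))//.
have := size_lagrange_le i; rewrite -addnn => h.
by rewrite (leq_trans (leq_pred _))// leq_add.
Qed.

(** The polynomial V(t) = prod_i (1 - t/y_i). *)
Definition node_poly1 := node_poly.[0]^-1 *: node_poly.

Lemma node_poly1_0 : node_poly1.[0] = 1.
Proof. by rewrite hornerZ mulVf// node_poly0_neq0. Qed.

Lemma size_node_poly1 : (size node_poly1 <= m.+1)%N.
Proof. by rewrite (leq_trans (size_scale_leq _ _))// size_node_poly. Qed.

Lemma node_poly1_node i : node_poly1.[y i] = 0.
Proof. by rewrite hornerZ node_poly_root mulr0. Qed.

(** V^2 has degree 2m, the last degree where the quadrature is exact, and vanishes at every node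
    except 0. *)
Lemma emean_node_poly1_sqr : emean (node_poly1 ^+ 2) = mass_at_zero p.
Proof.
rewrite emean_quadrature.
  rewrite horner_exp node_poly1_0 expr1n mulr1 big1 ?addr0// => i _.
  by rewrite horner_exp node_poly1_node expr0n mulr0.
rewrite expr2 (leq_trans (size_polyMleq _ _))//.
rewrite -subn1 leq_subLR (leq_trans (leq_add size_node_poly1 size_node_poly1))//.
by rewrite addnn doubleS.
Qed.

Lemma mass_at_zero_gt0 : 0 < mass_at_zero p.
Proof.
rewrite -emean_node_poly1_sqr; apply: emean_gt0.
  by move=> t _; rewrite horner_exp sqr_ge0.
rewrite expf_neq0//; apply/eqP => V0; have := node_poly1_0.
by rewrite V0 horner0 => /esym/eqP; rewrite oner_eq0.
Qed.

(** The quadrature settles a = 0; for a > 0 one factor t makes orthogonality apply. *)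
Lemma emean_Xn_node_poly1 (a : nat) : (a <= m)%N ->
  emean ('X^a * node_poly1) = mass_at_zero p * (a == 0%N)%:R.
Proof.
case: a => [|a] am.
  rewrite expr0 mul1r emean_quadrature; last first.
    by rewrite (leq_trans size_node_poly1)// ltnS -addnn leq_addr.
  rewrite node_poly1_0 big1 ?addr0// => i _.
  by rewrite node_poly1_node mulr0.
rewrite mulr0 -scalerAr emeanZ exprS -mulrA [_ * node_poly]mulrC.
by rewrite emean_node_poly_orthogonal ?mulr0// size_polyXn.
Qed.

(** * Inverse of the Hankel matrix *)

Lemma rVpoly_sum n (v : 'rV[R]_n) : rVpoly v = \sum_i v 0 i *: 'X^i.
Proof. by rewrite /rVpoly poly_def; apply: eq_bigr => i _; rewrite valK. Qed.

Lemma emean_mulXn_coef n (a : nat) g : (size g <= n)%N ->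
  emean ('X^a * g) = \sum_(b < n) normal_moment R (2 * (a + b)) * g`_b.
Proof.
move=> sg; have {1}-> : g = \sum_(b < n) g`_b *: 'X^b.
  rewrite -poly_def; apply/polyP => b; rewrite coef_poly.
  by case: ltnP => // nb; rewrite nth_default// (leq_trans sg).
rewrite mulr_sumr raddf_sum/=; apply: eq_bigr => b _.
by rewrite -scalerAr emeanZ -exprD emeanXn mulrC.
Qed.

(** The Hankel matrix is the Gram matrix of the monomials for [emean]; this makes it positive
    definite, hence invertible. *)
Lemma hankel_quadratic (v : 'rV[R]_m.+1) :
  \sum_b (v *m normal_hankel R m) 0 b * v 0 b = emean (rVpoly v ^+ 2).
Proof.
rewrite expr2 {2}rVpoly_sum mulr_sumr raddf_sum/=; apply: eq_bigr => b _.
rewrite -scalerAr emeanZ mulrC; congr (_ * _).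
rewrite mulrC (emean_mulXn_coef b (size_poly _ _)) mxE; apply: eq_bigr => a _.
by rewrite mxE coef_rVpoly_ord mulrC addnC.
Qed.

Lemma normal_hankel_unit : normal_hankel R m \in unitmx.
Proof.
rewrite unitmxE unitfE; apply/negP => /det0P[v v0 vH].
have := hankel_quadratic v; rewrite vH big1 => [|b _]; last by rewrite mxE mul0r.
have rv : rVpoly v != 0.
  by apply: contraNneq v0 => rv; rewrite -(rVpolyK v) rv raddf0.
apply/eqP; rewrite eq_sym gt_eqF// emean_gt0 ?expf_neq0// => t _.
by rewrite horner_exp sqr_ge0.
Qed.

Lemma normal_hankel_node_poly1 :
  normal_hankel R m *m (\col_b node_poly1`_b) =
  mass_at_zero p *: delta_mx ord0 ord0 :> 'cV_m.+1.
Proof.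
apply/matrixP => a j; rewrite (ord1 j) !mxE andbT.
have am : (a <= m)%N by rewrite -ltnS.
rewrite -(emean_Xn_node_poly1 am) (emean_mulXn_coef a size_node_poly1).
by apply: eq_bigr => b _; rewrite !mxE.
Qed.

(** Applying M^-1 to M V = p_0 e_0 and reading the top entry gives V(0) = 1 = p_0 (M^-1)_(1,1). *)
Lemma invmx_normal_hankel00 :
  1 / invmx (normal_hankel R m) ord0 ord0 = mass_at_zero p.
Proof.
have := congr1 (mulmx (invmx (normal_hankel R m))) normal_hankel_node_poly1.
rewrite mulKmx ?normal_hankel_unit// -scalemxAr -colE => /matrixP/(_ ord0 ord0).
rewrite !mxE/= -horner_coef0 node_poly1_0 => h.
have i0 : invmx (normal_hankel R m) ord0 ord0 != 0.
  by apply/eqP => i0; move: h; rewrite i0 mulr0 => /eqP; rewrite oner_eq0.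
by apply: (mulIf i0); rewrite divfK.
Qed.

End weights.
End gauss_hermite_quadrature.

(** * The extremal distribution *)

Section discrete_probability.
Context {R : realType}.
Implicit Types s : seq (R * R).

(** Atoms are pairs of a weight and a point; the measure is built by adding one scaled Dirac mass at
    a time. *)
Lemma ge0_discrete_measure s : (forall a, a \in s -> 0 <= a.1) ->
  exists2 mu : {measure set (measurableTypeR R) -> \bar R},
    forall A, mu A = (\sum_(a <- s) (a.1)%:E * \d_(a.2) A)%E &
    forall f : R -> \bar R, measurable_fun setT f -> (forall x, (0 <= f x)%E) ->
      (\int[mu]_x f x = \sum_(a <- s) (a.1)%:E * f a.2)%E.
Proof.
elim: s => [_|a s IHs as0].
  exists mzero => [A|f mf f0]; first by rewrite big_nil.
  by rewrite integral_measure_zero big_nil.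
have a0 : 0 <= a.1 by apply: as0; rewrite mem_head.
have [b bs|mu muE imu] := IHs; first by apply: as0; rewrite inE bs orbT.
exists (measure_add (mscale (NngNum a0) (dirac (a.2 : measurableTypeR R))) mu).
  by move=> A; rewrite big_cons -muE; exact: measure_addE.
move=> f mf f0; rewrite ge0_integral_measure_add//= big_cons imu//.
rewrite ge0_integral_mscale// integral_dirac// diracT mul1e.
by [].
Qed.

Lemma discrete_probability s : (forall a, a \in s -> 0 <= a.1) ->
  \sum_(a <- s) a.1 = 1 ->
  exists2 P : real_distribution R,
    forall A, P A = (\sum_(a <- s) (a.1)%:E * \d_(a.2) A)%E &
    forall f : R -> R, measurable_fun setT f ->
      P.-integrable setT (EFin \o f) /\
      (\int[P]_x (f x)%:E = (\sum_(a <- s) a.1 * f a.2)%:E)%E.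
Proof.
move=> s0 s1; have [mu muE imu] := ge0_discrete_measure s0.
have mu1 : mu setT = 1%E.
  rewrite muE -[RHS]/(1%:E) -s1 -sumEFin; apply: eq_bigr => a _.
  by rewrite diracT mule1.
(* Normalisation supplies the probability structure and changes nothing, the total mass being 1;
   [std_normal R] is only the default for degenerate masses. *)
pose P : real_distribution R := mnormalize mu (std_normal R).
have PE : (P : set _ -> \bar R) = mu.
  apply/funext => A.
  rewrite -[LHS]/(mnormalize mu (std_normal R) A) /mnormalize mu1.
  by rewrite onee_eq0/= invr1 mule1.
have iP (f : R -> \bar R) : measurable_fun setT f -> (forall x, (0 <= f x)%E) ->
    (\int[P]_x f x = \sum_(a <- s) (a.1)%:E * f a.2)%E.
  move=> mf f0; rewrite -imu//; apply: eq_measure_integral => A mA _.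
  by rewrite -[LHS]/((P : set _ -> \bar R) A) PE.
exists P => [A|f mf]; first by rewrite -[LHS]/((P : set _ -> \bar R) A) PE muE.
have mf' : measurable_fun setT (EFin \o f) by exact/measurable_EFinP.
split.
  apply/integrableP; split=> //.
  rewrite iP//; last by apply: measurableT_comp.
  by rewrite (eq_bigr (fun a : R * R => (a.1 * `|f a.2|)%:E))// sumEFin ltry.
rewrite integralE !iP//; [|exact: measurable_funeneg|exact: measurable_funepos].
rewrite (eq_bigr (fun a : R * R => (a.1 * Num.max (f a.2) 0)%:E)); last first.
  by move=> a _; rewrite funeposE -EFin_max.
rewrite [X in (_ - X)%E](eq_bigr
  (fun a : R * R => (a.1 * Num.max (- f a.2) 0)%:E)); last first.
  by move=> a _; rewrite funenegE -EFinN -EFin_max.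
rewrite !sumEFin -EFinB -sumrB; congr EFin; apply: eq_bigr => a _.
rewrite -mulrBr; congr (_ * _).
by case: (leP (f a.2) 0) => fa; case: (leP (- f a.2) 0) => fa'; lra.
Qed.

End discrete_probability.

(** * The law carried by the Gauss-Hermite nodes *)

Section extremal_distribution.
Context {R : realType} (m : nat) (y p : 'I_m -> R).
Hypothesis y_enum : enum_sq_nonzero_roots (hermite R m.*2.+1) y.
Hypothesis p_moment : moment_weights y p.

(** Positivity of the weights and of the mass at zero is what makes the signed set function a
    probability. *)
Lemma symmetric_discrete_probability :
  exists2 P : real_distribution R,
    forall A, P A = symmetric_discrete y p A &
    forall f : R -> R, measurable_fun setT f ->
      P.-integrable setT (EFin \o f) /\
      (\int[P]_x (f x)%:E =
       (mass_at_zero p * f 0 +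
        \sum_i p i * (f (Num.sqrt (y i)) + f (- Num.sqrt (y i))))%:E)%E.
Proof.
pose s := (mass_at_zero p, 0) ::
  [seq (p i, Num.sqrt (y i)) | i : 'I_m] ++
  [seq (p i, - Num.sqrt (y i)) | i : 'I_m].
have s0 a : a \in s -> 0 <= a.1.
  rewrite inE mem_cat => /orP[/eqP -> /=|/orP[] /mapP[i _ ->] /=].
  - exact/ltW/(mass_at_zero_gt0 y_enum).
  - exact/ltW/(weight_gt0 y_enum).
  - exact/ltW/(weight_gt0 y_enum).
have s1 : \sum_(a <- s) a.1 = 1.
  by rewrite big_cons big_cat !big_image/= /mass_at_zero; ring.
have [P PE iP] := discrete_probability s0 s1; exists P => [A|f mf].
  rewrite PE big_cons big_cat !big_image/= -big_split/=.
  congr (_ + _)%E; apply: eq_bigr => i _.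
  by rewrite ge0_muleDr.
have [intf ->] := iP f mf; split=> //; congr EFin.
rewrite big_cons big_cat !big_image/= -big_split/=.
by congr (_ + _); apply: eq_bigr => i _; rewrite mulrDr.
Qed.

(** Odd moments cancel by symmetry. An even order j <= 4m is a power t^(j/2) of degree at most 2m,
    within the exactness of the quadrature, although the weight system only prescribes the first m
    even moments. *)
Lemma symmetric_discrete_matching (P : real_distribution R) :
  (forall f : R -> R, measurable_fun setT f ->
      P.-integrable setT (EFin \o f) /\
      (\int[P]_x (f x)%:E =
       (mass_at_zero p * f 0 +
        \sum_i p i * (f (Num.sqrt (y i)) + f (- Num.sqrt (y i))))%:E)%E) ->
  matches_even_normal_moments m.*2 P.
Proof.
move=> iP j /andP[j1 jm].
have [intj Ej] := iP (fun x => x ^+ j) (measurable_exprn j).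
split=> //; rewrite unlock Ej; congr EFin.
rewrite expr0n gtn_eqF// mulr0 add0r.
have [oj|ej] := boolP (odd j).
  rewrite normal_moment_odd// big1// => i _.
  by rewrite exprNn -signr_odd oj expr1 mulN1r subrr mulr0.
have -> : j = (2 * j./2)%N by rewrite mul2n even_halfK.
rewrite -emeanXn (emean_quadrature y_enum p_moment); last first.
  by rewrite size_polyXn ltnS -leq_double even_halfK// -mul2n.
rewrite hornerXn expr0n.
have -> : (j./2 == 0)%N = false by case: j ej j1 {jm intj Ej} => [|[|j]].
rewrite mulr0 add0r; apply: eq_bigr => i _.
rewrite hornerXn !exprM sqrrN sqr_sqrtr ?ltW ?(node_gt0 y_enum)//.
by ring.
Qed.

(** The half-line contains 0 and each -sqrt(y_i), but no sqrt(y_i), so its mass is p_0 + sum_i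
    p_i. *)
Lemma symmetric_discrete_cdf0 (P : real_distribution R) :
  (forall A, P A = symmetric_discrete y p A) ->
  dcdf P 0 = 1 / 2 + mass_at_zero p / 2.
Proof.
move=> PE; rewrite /dcdf PE /symmetric_discrete.
have d0 (x : R) : (\d_x [set` `]-oo, 0%R]] = ((x <= 0)%R)%:R%:E :> \bar R)%E.
  by rewrite /dirac indicE mem_setE in_itv.
rewrite d0 lexx mule1 (eq_bigr (fun i => (p i)%:E)) => [|i _]; last first.
  have := node_gt0 y_enum i => yi.
  by rewrite !d0 oppr_le0 sqrtr_ge0 leNgt sqrtr_gt0 yi/= add0e mule1.
by rewrite sumEFin/= /mass_at_zero; field.
Qed.

Lemma symmetric_discrete_atom0 (P : real_distribution R) :
  (forall A, P A = symmetric_discrete y p A) ->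
  P [set 0%R] = (mass_at_zero p)%:E.
Proof.
move=> PE; rewrite PE /symmetric_discrete.
have d0 (x : R) : (\d_x [set 0%R] = ((x == 0)%R)%:R%:E :> \bar R)%E.
  rewrite diracE (_ : (x \in [set 0%R]) = (x == 0))//.
  by apply/idP/eqP => [/set_mem//|->]; exact: mem_set.
rewrite d0 eqxx mule1 big1 ?adde0// => i _.
have := node_gt0 y_enum i => yi.
by rewrite !d0 oppr_eq0 gt_eqF ?sqrtr_gt0//= adde0 mule0.
Qed.

End extremal_distribution.

(** * Extremality *)

Section sign_approximation.
Context {R : realType}.
Implicit Types (u v x d : R) (n : nat).

Lemma atan_diff_bounds u v : 0 <= u -> u <= v ->
  (v - u) / (1 + v ^+ 2) <= atan v - atan u <= (v - u) / (1 + u ^+ 2).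
Proof.
move=> u0; rewrite le_eqVlt => /predU1P[->|uv]; first by rewrite !subrr !mul0r lexx.
have catan : {within `[u, v], continuous (@atan R)}.
  by apply: continuous_subspaceT => z; exact: continuous_atan.
have datan z : z \in `]u, v[ -> is_derive z 1 (@atan R) (1 + z ^+ 2)^-1.
  by move=> _; exact: is_derive1_atan.
have [c] := MVT uv datan catan.
rewrite in_itv/= => /andP[uc cv] ->; rewrite ![_^-1 * _]mulrC.
have vu0 : 0 <= v - u by rewrite subr_ge0 ltW.
have pos (z : R) : 0 < 1 + z ^+ 2 by rewrite ltr_pwDl// sqr_ge0.
by rewrite !ler_wpM2l// lef_pV2 ?posrE// lerD2l lerXn2r// ?nnegrE; lra.
Qed.

(** Right-endpoint Riemann sum, of step d, for the integral of 1/(1 + t^2) over [0, n d]. *)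
Definition atan_riemann d n := \sum_(j < n) d / (1 + (j.+1%:R * d) ^+ 2).

Lemma atan_riemann_bounds d n : 0 < d ->
  atan (n.+1%:R * d) - atan d <= atan_riemann d n <= atan (n%:R * d).
Proof.
move=> d0; elim: n => [|n /andP[IHl IHu]].
  by rewrite /atan_riemann big_ord0 mul1r mul0r subrr atan0 lexx.
have le1 (j : nat) : 0 <= j%:R * d /\ j%:R * d <= j.+1%:R * d.
  by split; [rewrite mulr_ge0// ltW|rewrite ler_pM2r// ler_nat].
have dif (j : nat) : j.+1%:R * d - j%:R * d = d.
  by rewrite -mulrBl -natrB// subSnn mul1r.
have [h0 h1] := le1 n; have [h2 h3] := le1 n.+1.
have := atan_diff_bounds h0 h1; have := atan_diff_bounds h2 h3.
rewrite !dif /atan_riemann big_ord_recr/= -/(atan_riemann d n).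
by move=> /andP[_ a1] /andP[a2 _]; apply/andP; split; lra.
Qed.

(** Riemann sum for the integral of x/(x^2 + r^2) in r, with step 1/(n+1). Taking (n+1)^2 terms lets
    the range [0, n+1] grow while the step shrinks. *)
Definition sign_approx n x := \sum_(j < n.+1 ^ 2)
  n.+1%:R^-1 * (x / (x ^+ 2 + (j.+1%:R / n.+1%:R) ^+ 2)).

Lemma sign_approxN n x : sign_approx n (- x) = - sign_approx n x.
Proof.
rewrite /sign_approx -sumrN; apply: eq_bigr => j _.
by rewrite sqrrN mulNr mulrN.
Qed.

Lemma sign_approx0 n : sign_approx n 0 = 0.
Proof. by rewrite /sign_approx big1// => j _; rewrite mul0r mulr0. Qed.

(** The substitution r = x t divides the step by x. *)
Lemma sign_approxE n x : 0 < x ->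
  sign_approx n x = atan_riemann (n.+1%:R * x)^-1 (n.+1 ^ 2).
Proof.
move=> x0; apply: eq_bigr => j _.
have n0 : n.+1%:R != 0 :> R by rewrite pnatr_eq0.
have h (a b c : R) : 0 < a -> 0 < b -> 0 <= c ->
    a^-1 * (b / (b ^+ 2 + (c / a) ^+ 2)) = (a * b)^-1 / (1 + (c * (a * b)^-1) ^+ 2).
  move=> a0 b0 c0; field; rewrite !gt_eqF//; repeat split => //.
  by rewrite ltr_pwDl ?sqr_ge0// exprn_gt0// mulr_gt0.
by apply: h.
Qed.

(** By oddness x > 0 suffices; there the arctangent bounds put the sum between 0 and pi/2. *)
Lemma sign_approx_bound n x : `|sign_approx n x| <= pi / 2 * `|Num.sg x|.
Proof.
wlog x0 : x / 0 < x => [wh|].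
  have [x0|x0|x0] := ltgtP x 0.
  - by rewrite -[x]opprK sign_approxN sgrN !normrN wh// oppr_gt0.
  - exact: wh.
  - by rewrite x0 sign_approx0 sgr0 normr0 mulr0.
have d0 : 0 < (n.+1%:R * x)^-1 by rewrite invr_gt0 mulr_gt0.
have /andP[l u] := atan_riemann_bounds (n.+1 ^ 2) d0.
rewrite sign_approxE// gtr0_sg// normr1 mulr1 ger0_norm.
  by rewrite (le_trans u)// ltW// atan_ltpi2.
rewrite (le_trans _ l)// subr_ge0 le_atan// ler_peMl ?ler1n//.
exact: ltW.
Qed.

Lemma sign_approx_le n x : `|sign_approx n x| <= pi / 2.
Proof.
rewrite (le_trans (sign_approx_bound n x))// normr_sg.
by case: (x != 0); rewrite ?mulr1// mulr0 divr_ge0// pi_ge0.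
Qed.

Lemma cvg_sign_approx x : sign_approx n x @[n --> \oo] --> pi / 2 * Num.sg x.
Proof.
wlog x0 : x / 0 < x => [wh|].
  have [x0|x0|x0] := ltgtP x 0.
  - rewrite -[x]opprK sgrN mulrN.
    under eq_fun do rewrite sign_approxN.
    by apply: cvgN; apply: wh; rewrite oppr_gt0.
  - exact: wh.
  - rewrite x0 sgr0 mulr0; under eq_fun do rewrite sign_approx0.
    exact: cvg_cst.
rewrite gtr0_sg// mulr1.
apply: (@squeeze_cvgr _ _ _ _
  (fun n => atan (x^-1 * n.+1%:R) - atan (x^-1 * n.+1%:R^-1)) (cst (pi / 2))).
- near=> n; have d0 : 0 < (n.+1%:R * x)^-1 by rewrite invr_gt0 mulr_gt0.
  have /andP[l u] := atan_riemann_bounds (n.+1 ^ 2) d0.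
  rewrite sign_approxE// (le_trans u (ltW (atan_ltpi2 _))) andbT (le_trans _ l)//.
  have n0 : n.+1%:R != 0 :> R by rewrite pnatr_eq0.
  have -> : x^-1 * n.+1%:R = (n.+1 ^ 2)%:R / (n.+1%:R * x).
    rewrite natrX; move: (n.+1%:R) n0 => a a0.
    by field; rewrite a0 gt_eqF.
  have -> : x^-1 / n.+1%:R = (n.+1%:R * x)^-1 by rewrite mulrC -invfM.
  by rewrite lerD2r le_atan// ler_pM2r// ler_nat.
- rewrite -[X in _ --> X]subr0 -atan0; apply: cvgB.
    apply: (cvg_comp _ _ _ (@cvgy_atan R)).
    have natSy : (n.+1%:R : R) @[n --> \oo] --> +oo.
      apply/cvgryPge => A; near=> n.
      rewrite (le_trans (ler_norm A))// (le_trans (ltW (truncnS_gt _)))//.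
      rewrite ler_nat ltnS.
      by near: n; exists (Num.truncn `|A|).
    apply: (cvg_comp _ (fun r => x^-1 * r) natSy).
    by apply: gt0_cvgMry; [rewrite invr_gt0|exact: cvg_id].
  have cvg0 : x^-1 * n.+1%:R^-1 @[n --> \oo] --> (0 : R).
    by rewrite -[X in _ --> X](mulr0 x^-1); apply: cvgMr; exact: cvg_harmonic.
  exact: (cvg_comp _ _ cvg0 (@continuous_atan R 0)).
- exact: cvg_cst.
Unshelve. all: by end_near. Qed.

Lemma measurable_sign_approx n : measurable_fun setT (sign_approx n).
Proof.
apply: measurable_sum => j; apply: continuous_measurable_fun => x.
apply: cvgMr; apply: cvgM; first exact: cvg_id.
apply: cvgV.
  by rewrite gt_eqF// ltr_wpDl ?sqr_ge0// exprn_gt0// divr_gt0.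
by apply: cvgD; [exact: exprn_continuous|exact: cvg_cst].
Qed.

End sign_approximation.

(** * Bounds on the atom and on the c.d.f. at zero *)

Section atom_bound.
Context {R : realType} (m : nat) (y p : 'I_m -> R).
Hypothesis y_enum : enum_sq_nonzero_roots (hermite R m.*2.+1) y.
Hypothesis p_moment : moment_weights y p.
Local Notation gmean := (expect_poly (std_normal R)).
Local Notation V := (node_poly1 y).
Local Notation w := (node_poly1 y ^+ 2).

Lemma size_node_poly1_sqr : (size w <= m.*2.+1)%N.
Proof.
rewrite expr2 (leq_trans (size_polyMleq _ _))// -subn1 leq_subLR.
rewrite (leq_trans (leq_add (size_node_poly1 y) (size_node_poly1 y)))//.
by rewrite addnn doubleS.
Qed.

Lemma node_poly1_opp_ge1 (s : R) : 0 <= s -> 1 <= V.[- s].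
Proof.
move=> s0; rewrite hornerZ !horner_node_poly -prodfV -big_split/=.
elim/big_ind: _ => // [a b|i _]; first exact: mulr_ege1.
have yi := node_gt0 y_enum i.
have -> : (0 - y i)^-1 * (- s - y i) = 1 + s / y i by field; rewrite gt_eqF.
by rewrite lerDl divr_ge0// ltW.
Qed.

Lemma gmean_odd (g : {poly R}) : gmean ('X * (g \Po 'X^2)) = 0.
Proof.
rewrite -[g]coefK poly_def raddf_sum mulr_sumr raddf_sum/= big1// => i _.
rewrite linearZ/= comp_Xn_poly -scalerAr gmeanZ -exprM -exprS gmeanXn.
by rewrite normal_moment_odd ?mulr0//= oddM.
Qed.

(** Writing [Num.sg x * f x] for |f x| makes the bound linear in f, hence stable under nonnegative
    combinations. The size bound lets any matching law integrate U as the normal law does. *)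
Definition odd_approximable (f : R -> R) := exists U : {poly R},
  [/\ (size U <= (2 * m.*2).+1)%N, gmean U = 0 &
      forall x, `|f x - U.[x]| <= w.[x ^+ 2] * (Num.sg x * f x)].

Lemma odd_approximable_kernel (s : R) : 0 < s ->
  odd_approximable (fun x => x / (x ^+ 2 + s)).
Proof.
move=> s0; have V1 := node_poly1_opp_ge1 (ltW s0).
have w1 : 1 <= w.[- s] by rewrite horner_exp expr_ge1// (le_trans ler01).
have w0 : 0 < w.[- s] by exact: lt_le_trans w1.
(* D(t) = (1 - w(t)/w(-s))/(t + s) is a polynomial; U = x D(x^2) then leaves the error
   (w(x^2)/w(-s)) x/(x^2 + s). *)
have /factor_theorem[D AD] : root (1 - w.[- s]^-1 *: w) (- s).
  by rewrite /root hornerD hornerN hornerZ hornerC mulVf ?subrr// gt_eqF.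
have sD : (size D <= m.*2)%N.
  have [->|D0] := eqVneq D 0; first by rewrite size_poly0.
  rewrite -ltnS (leq_trans _ size_node_poly1_sqr)//.
  have : (size (D * ('X - (- s)%:P))%R <= maxn 1 (size w))%N.
    rewrite -AD (leq_trans (size_polyD _ _))// size_poly1 size_polyN.
    by rewrite geq_max leq_maxl leq_max size_scale_leq orbT.
  rewrite size_Mmonic ?monicXsubC// size_XsubC addn2/=.
  by rewrite leq_max ltnS leqn0 size_poly_eq0 (negbTE D0).
have DE x : D.[x ^+ 2] = (1 - w.[- s]^-1 * w.[x ^+ 2]) / (x ^+ 2 + s).
  have xs : x ^+ 2 + s != 0 by rewrite gt_eqF// ltr_wpDl// sqr_ge0.
  apply: (mulIf xs); rewrite divfK//.
  have := congr1 (fun q => q.[x ^+ 2]) AD.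
  rewrite [in RHS]hornerM [in RHS]hornerXsubC opprK => <-.
  by rewrite hornerD hornerN hornerZ hornerC.
exists ('X * (D \Po 'X^2)); split; last 1 first.
- move=> x; rewrite hornerM hornerX horner_comp_sqr DE.
  have xs : 0 < x ^+ 2 + s by rewrite ltr_wpDl// sqr_ge0.
  have -> : x / (x ^+ 2 + s) - x * ((1 - w.[- s]^-1 * w.[x ^+ 2]) / (x ^+ 2 + s)) =
      w.[x ^+ 2] * (x / (x ^+ 2 + s)) / w.[- s].
    by field; rewrite !gt_eqF.
  have wx : 0 <= w.[x ^+ 2] by rewrite horner_exp sqr_ge0.
  rewrite !normrM !normfV (ger0_norm wx) (gtr0_norm xs) (gtr0_norm w0).
  rewrite [Num.sg x * _]mulrA -(normrEsg x) ler_pdivrMr// ler_peMr//.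
  by rewrite mulr_ge0// mulr_ge0// invr_ge0 ltW.
- have [->|D0] := eqVneq D 0; first by rewrite comp_poly0 mulr0 size_poly0.
  rewrite mulrC size_mulX ?comp_poly_eq0 ?size_polyXn//.
  rewrite ltnS (leq_trans (size_comp_poly_leq _ _))// size_polyXn/=.
  rewrite mulnC ltn_pmul2l//.
  by rewrite prednK// size_poly_gt0.
- exact: gmean_odd.
Qed.

Lemma odd_approximable_sum (I : finType) (c : I -> R) (f : I -> R -> R) :
  (forall i, 0 <= c i) -> (forall i, odd_approximable (f i)) ->
  odd_approximable (fun x => \sum_i c i * f i x).
Proof.
move=> c0 /choice[U fU]; exists (\sum_i c i *: U i); split.
- apply: (leq_trans (size_sum _ _ _)); apply/bigmax_leqP => i _.
  by rewrite (leq_trans (size_scale_leq _ _))//; have [] := fU i.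
- rewrite raddf_sum/= big1// => i _; rewrite gmeanZ.
  by have [_ ->] := fU i; rewrite mulr0.
- move=> x; rewrite horner_sum -sumrB !mulr_sumr.
  apply: (le_trans (ler_norm_sum _ _ _)); apply: ler_sum => i _.
  rewrite hornerZ -mulrBr normrM (ger0_norm (c0 i)).
  rewrite [leRHS](_ : _ = c i * (w.[x ^+ 2] * (Num.sg x * f i x))); last by ring.
  by rewrite ler_wpM2l//; have [_ _ ->] := fU i.
Qed.

Lemma odd_approximable_sign n : odd_approximable (sign_approx n).
Proof.
apply: odd_approximable_sum => j; first by rewrite invr_ge0.
by apply: odd_approximable_kernel; rewrite exprn_gt0// divr_gt0.
Qed.

Variable Q : real_distribution R.
Hypothesis Q_moment : matches_even_normal_moments m.*2 Q.
Let q0 : R := fine (Q [set 0%R]).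

Lemma fin_num_atom0 : Q [set 0%R] \is a fin_num.
Proof. exact: fin_num_measure. Qed.

Lemma expect_atom0 : \int[Q]_x \1_[set 0%R] x = q0.
Proof. by rewrite /Rintegral integral_indic// setIT. Qed.

(** w(x^2) has degree at most 4m, the highest matched order, so its mean is the same under Q as
    under the normal law. *)
Lemma integrable_node_poly1_sqr :
  Q.-integrable setT (fun x : R => (w.[x ^+ 2])%:E) /\
  \int[Q]_x w.[x ^+ 2] = mass_at_zero p.
Proof.
have sw : (size (w \Po 'X^2) <= (2 * m.*2).+1)%N.
  rewrite (leq_trans (size_comp_poly_leq _ _))// size_polyXn/= mulnC ltnS.
  by rewrite leq_pmul2l// -subn1 leq_subLR size_node_poly1_sqr.
have [] := expect_poly_matching Q_moment sw.
rewrite -/(emean w) (emean_node_poly1_sqr y_enum p_moment) /expect_poly.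
under eq_fun do rewrite horner_comp_sqr.
by under eq_Rintegral do rewrite horner_comp_sqr.
Qed.

Lemma atom0_le : q0 <= mass_at_zero p.
Proof.
have [iw <-] := integrable_node_poly1_sqr; rewrite -expect_atom0.
apply: le_Rintegral => //; first exact: integrable_indic.
move=> x _; rewrite indicE; case: (boolP (x \in _)) => [/set_mem ->|_].
  by rewrite expr0n horner_exp (node_poly1_0 y_enum) expr1n.
by rewrite horner_exp sqr_ge0.
Qed.

Lemma integrable_sign_approx n :
  Q.-integrable setT (fun x : R => (sign_approx n x)%:E).
Proof.
apply: measurable_bounded_integrable => //.
- by rewrite (le_lt_trans (probability_le1 _ _)) ?ltry.
- exact: measurable_sign_approx.
exists (pi / 2); split; first exact: num_real.
move=> B piB x _ /=; exact: le_trans (sign_approx_le n x) (ltW piB).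
Qed.

Lemma expect_sign_approx_le n :
  `|\int[Q]_x sign_approx n x| <= pi / 2 * (mass_at_zero p - q0).
Proof.
have [U [sU U0 fU]] := odd_approximable_sign n.
have [iU] := expect_poly_matching Q_moment sU; rewrite U0 => EU.
have [iw Ew] := integrable_node_poly1_sqr.
have iS := integrable_sign_approx n.
have iI : Q.-integrable setT (fun x : R => (\1_[set 0%R] x)%:E).
  exact: integrable_indic.
have iSU : Q.-integrable setT (EFin \o (fun x : R => sign_approx n x - U.[x])).
  exact: (integrableB _ iS iU).
have iwI : Q.-integrable setT (EFin \o (fun x : R => w.[x ^+ 2] - \1_[set 0%R] x)).
  exact: (integrableB _ iw iI).
have -> : \int[Q]_x sign_approx n x = \int[Q]_x (sign_approx n x - U.[x]).
  by rewrite RintegralB// -[X in _ - X]/(expect_poly Q U) EU subr0.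
rewrite -Ew -expect_atom0 -RintegralB// -RintegralZl//.
apply: (le_trans (le_normr_Rintegral _ _)) => //.
apply: le_Rintegral => //.
- exact: integrable_norm.
- exact: (integrableZl _ (pi / 2) iwI).
move=> x _; apply: (le_trans (fU x)).
(* At 0 the sign kills the left side and w(0) = 1 cancels the indicator; elsewhere the indicator
   vanishes and |S| <= pi/2 for S = [sign_approx n]. *)
have [->|x0] := eqVneq x 0.
  rewrite sgr0 mul0r mulr0 mulr_ge0 ?divr_ge0 ?pi_ge0// subr_ge0 expr0n.
  by rewrite horner_exp (node_poly1_0 y_enum) expr1n indicE mem_set.
rewrite indicE memNset ?subr0; last by move/eqP; rewrite (negbTE x0).
rewrite [leRHS]mulrC ler_wpM2l//; first by rewrite horner_exp sqr_ge0.
rewrite (le_trans (ler_norm _))// normrM normr_sg x0 mul1r.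
by rewrite (le_trans (sign_approx_bound n x))// normr_sg x0 mulr1.
Qed.

Lemma sgr_indicE (x : R) :
  Num.sg x = 1 - 2 * \1_[set` `]-oo, 0%R]] x + \1_[set 0%R] x.
Proof.
rewrite !indicE mem_setE in_itv/=.
have -> : (x \in [set 0%R]) = (x == 0).
  by apply/idP/eqP => [/set_mem//|->]; exact: mem_set.
by case: sgrP => _ /=; lra.
Qed.

Lemma integrable_sg : Q.-integrable setT (fun x : R => (Num.sg x)%:E).
Proof.
have i1 : Q.-integrable setT (EFin \o (cst 1 : R -> R)).
  exact: finite_measure_integrable_cst.
have i2 : Q.-integrable setT (EFin \o (\1_[set` `]-oo, 0%R]] : R -> R)).
  exact: integrable_indic.
have i3 : Q.-integrable setT (EFin \o (\1_[set 0%R] : R -> R)).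
  exact: integrable_indic.
have i12 := integrableB measurableT i1 (integrableZl measurableT 2 i2).
have := integrableD measurableT i12 i3.
apply: eq_integrable => // x _ /=.
by rewrite sgr_indicE.
Qed.

Lemma expect_sg : \int[Q]_x Num.sg x = 1 - 2 * dcdf Q 0 + q0.
Proof.
have i1 : Q.-integrable setT (EFin \o (cst 1 : R -> R)).
  exact: finite_measure_integrable_cst.
have i2 : Q.-integrable setT (EFin \o (\1_[set` `]-oo, 0%R]] : R -> R)).
  exact: integrable_indic.
have i3 : Q.-integrable setT (EFin \o (\1_[set 0%R] : R -> R)).
  exact: integrable_indic.
have i2' := integrableZl measurableT 2 i2.
under eq_Rintegral do rewrite sgr_indicE.
rewrite RintegralD//; last exact: (integrableB measurableT i1 i2').
rewrite RintegralB// RintegralZl// Rintegral_cst// expect_atom0 mul1r.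
rewrite [X in fine X](probability_setT Q) /dcdf.
by rewrite [\int[Q]_x \1_[set` `]-oo, 0%R]] x]/Rintegral integral_indic// setIT.
Qed.

(** Limit of the bounds for [sign_approx n], by dominated convergence with the constant pi/2. *)
Lemma expect_sg_le : `|\int[Q]_x Num.sg x| <= mass_at_zero p - q0.
Proof.
have pi0 : 0 < pi / 2 :> R by rewrite divr_gt0 ?pi_gt0.
rewrite -(ler_pM2l pi0) -{1}(gtr0_norm pi0) -normrM.
rewrite -RintegralZl//; last exact: integrable_sg.
set B := pi / 2 * _.
have mS n : measurable_fun setT (fun x : R => (sign_approx n x)%:E).
  exact: measurable_int (integrable_sign_approx n).
have isg : Q.-integrable setT (fun x : R => (pi / 2 * Num.sg x)%:E).
  exact: (integrableZl measurableT (pi / 2) integrable_sg).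
have [|||_ _ cvgS] := @dominated_convergence _ _ _ Q setT measurableT
  (fun n x => (sign_approx n x)%:E) (fun x => (pi / 2 * Num.sg x)%:E)
  (cst (pi / 2)%:E) mS (measurable_int _ isg).
- by apply: aeW => x _; apply: cvg_EFin; [near=> n|exact: cvg_sign_approx].
- exact: (@finite_measure_integrable_cst _ _ _ Q setT (pi / 2)).
- by apply: aeW => x n _ /=; rewrite lee_fin; exact: sign_approx_le.
have fin : (\int[Q]_x (pi / 2 * Num.sg x)%:E)%E \is a fin_num.
  by apply: integrable_fin_num.
have cvgr : \int[Q]_x sign_approx n x @[n --> \oo] -->
    \int[Q]_x (pi / 2 * Num.sg x).
  by apply: fine_cvg; rewrite fineK.
have cvga : `|\int[Q]_x sign_approx n x| @[n --> \oo] -->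
    `|\int[Q]_x (pi / 2 * Num.sg x)|.
  exact: cvg_norm.
rewrite -(cvg_lim _ cvga)//; apply: limr_le.
  by apply/cvg_ex; eexists; exact: cvga.
by near=> n; exact: expect_sign_approx_le.
Unshelve. all: by end_near. Qed.

(** From |1 - 2F(0) + q0| <= p_0 - q0 one gets 2F(0) - 1 <= p_0 and 1 - 2F(0) <= p_0 - 2 q0 <=
    p_0. *)
Lemma dcdf0_bound : `|dcdf Q 0 - 1 / 2| <= mass_at_zero p / 2.
Proof.
have := expect_sg_le; rewrite expect_sg.
have q00 : 0 <= q0 by rewrite fine_ge0.
by rewrite !ler_norml => /andP[h1 h2]; apply/andP; split; lra.
Qed.

End atom_bound.

Theorem theorem3 (R : realType) (k : nat)
    (k_ge2 : (2 <= k)%N) (k_even : ~~ odd k) :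
  (exists y : 'I_(k./2) -> R, enum_sq_nonzero_roots (hermite R k.+1) y) /\
  forall y : 'I_(k./2) -> R, enum_sq_nonzero_roots (hermite R k.+1) y ->
  (exists! p : 'I_(k./2) -> R, weight_system y p) /\
  forall p : 'I_(k./2) -> R, weight_system y p ->
  normal_hankel R k./2 \in unitmx /\
  exists Fstar : real_distribution R,
    [/\ forall A : set (measurableTypeR R), measurable A -> Fstar A = symmetric_discrete y p A,
        matches_even_normal_moments k Fstar,
        dcdf Fstar 0 - dcdf (std_normal R) 0 =
          1 / 2%:R * (1 / invmx (normal_hankel R k./2) ord0 ord0),
        forall Q : real_distribution R, matches_even_normal_moments k Q ->
          `|dcdf Q 0 - dcdf (std_normal R) 0|
            <= `|dcdf Fstar 0 - dcdf (std_normal R) 0|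
      & forall Q : real_distribution R, matches_even_normal_moments k Q ->
          (Q [set 0%R] <= Fstar [set 0%R])%E].
Proof.
(* Everything is applied with m = [k./2]; only the Hermite degree and the matching order are
   rewritten, so the index type of y and p is unchanged. *)
have kE : k = k./2.*2 by rewrite even_halfK.
have hE : hermite R k.+1 = hermite R k./2.*2.+1 by rewrite -kE.
have matchE P : matches_even_normal_moments k P ->
    @matches_even_normal_moments R k./2.*2 P by rewrite -kE.
rewrite hE; split; first exact: hermite_odd_enum_sq.
move=> y y_enum; split.
  exists (gauss_weight y); split; first exact: gauss_weight_moment.
  by move=> p hp; apply/funext => i; rewrite (moment_weights_unique y_enum hp).
move=> p hp; split; first exact: normal_hankel_unit.
have [F FE iF] := symmetric_discrete_probability y_enum hp.
have p0 := mass_at_zero_gt0 y_enum hp.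
have dF : dcdf F 0 - dcdf (std_normal R) 0 = mass_at_zero p / 2.
  by rewrite (symmetric_discrete_cdf0 y_enum FE) dcdf_std_normal0 addrAC subrr add0r.
exists F; split.
- by move=> A _; exact: FE.
- rewrite [X in matches_even_normal_moments X]kE.
  exact: symmetric_discrete_matching hp _ iF.
- by rewrite dF (invmx_normal_hankel00 y_enum hp); field.
- move=> Q /matchE hQ; rewrite dF dcdf_std_normal0.
  rewrite (ger0_norm (divr_ge0 (ltW p0) _))//.
  exact: dcdf0_bound hp _ hQ.
- move=> Q /matchE hQ; rewrite (symmetric_discrete_atom0 y_enum FE).
  rewrite -(fineK (fin_num_atom0 Q)) lee_fin.
  exact: atom0_le hp _ hQ.
Qed.
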